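(* For any integers $e \ge 4$ and $n \ge e+2$, exactly one of the following three statements holds: (i) $\rho(\mathcal{V}_{n,e}) < \rho(\mathcal{D}_{n,e}) < \psi_e$; (ii) $\rho(\mathcal{V}_{n,e}) = \rho(\mathcal{D}_{n,e}) = \psi_e$; (iii) $\rho(\mathcal{V}_{n,e}) > \rho(\mathcal{D}_{n,e}) > \psi_e$.
   Context: All graphs are undirected, finite and simple. The spectral radius $\rho(G)$ of a graph $G$ is the largest modulus of an eigenvalue of its adjacency matrix. $G_1 \lor G_2$ and $G_1 + G_2$ denote the join and the disjoint union of graphs; $K_0$ (and $0K_1$) is the empty graph on no vertices, which is neutral for both operations. For an integer $e \ge 1$, let $k_e$ be the largest natural number with $\binom{k_e}{2} \le e$, and let $t_e = e - \binom{k_e}{2}$ (so $0 \le t_e \le k_e - 1$). Let $b_e = k_e + 1$ if $t_e = 0$, and $b_e = k_e + 2$ if $t_e \ne 0$. For $n \ge b_e$, the graph $\mathcal{D}_{n,e}$ (connected, with $n$ vertices and $n-1+e$ edges) is $$\mathcal{D}_{n,e} = \big( ( (K_{k_e - t_e} + K_1) \lor K_{t_e} ) + (n - k_e - 2) K_1 \big) \lor K_1 \quad \text{if } n \ge k_e + 2, \qquad \mathcal{D}_{n,e} = K_n \quad \text{if } n < k_e + 2.$$ For $n \ge e+2$, the graph $\mathcal{V}_{n,e}$ (connected, with $n$ vertices and $n-1+e$ edges) is $\mathcal{V}_{n,e} = (K_{1,e} + (n-e-2)K_1) \lor K_1$. For $e \ge 4$, writing $k = k_e$, $t = t_e$, define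 the polynomial \begin{align*} \Psi_e(\lambda) &= \lambda^3 (k-1)(k-2)(k^2-3k+4t)\\ &\quad - \lambda^2 \big(k^5 - 6k^4 + k^3(4t+15) - k^2(20t+18) + k(8t^2+24t+8) - (4t^2+12t)\big)\\ &\quad - \lambda (k^2-k+2t)\big(k^3 + k^2(t-4) - k(3t-5) + (4t^2-2t-2)\big)\\ &\quad + t(k-t-1)(k^2-3k+2t)(k^2-k+2t), \end{align*} and let $\psi_e$ be the largest real root of $\Psi_e$ (it exists). *)

(* Defs.v *)
From HB Require Import structures.
From mathcomp Require Import all_boot all_order all_algebra.
From mathcomp Require Import zify ring lra.
From mathcomp Require Import all_classical all_reals.
From mathcomp.real_closed Require Import polyrcf complex.

Set Implicit Arguments.
Unset Strict Implicit.
Unset Printing Implicit Defensive.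

Import Order.TTheory GRing.Theory Num.Theory.

Record sgraph := SGraph {
  vertex :> finType;
  adj : rel vertex;
  adj_sym : symmetric adj;
  adj_irr : irreflexive adj }.

Section Complete.
Variable n : nat.
Definition complete_adj : rel 'I_n := fun x y => x != y.
Lemma complete_sym : symmetric complete_adj.
Proof. by move=> x y; rewrite /complete_adj eq_sym. Qed.
Lemma complete_irr : irreflexive complete_adj.
Proof. by move=> x; rewrite /complete_adj eqxx. Qed.
Definition complete := SGraph complete_sym complete_irr.
End Complete.

(* The disjoint union of [n] copies of K_1. *)
Section Edgeless.
Variable n : nat.
Definition edgeless_adj : rel 'I_n := fun _ _ => false.
Lemma edgeless_sym : symmetric edgeless_adj. Proof. by []. Qed.
Lemma edgeless_irr : irreflexive edgeless_adj. Proof. by []. Qed.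
Definition edgeless := SGraph edgeless_sym edgeless_irr.
End Edgeless.

Section Sums.
Variables G H : sgraph.

Definition dunion_adj : rel (G + H)%type := fun x y =>
  match x, y with
  | inl u, inl v => adj u v
  | inr u, inr v => adj u v
  | _, _ => false
  end.
Lemma dunion_sym : symmetric dunion_adj.
Proof. by move=> [u|u] [v|v] //=; rewrite adj_sym. Qed.
Lemma dunion_irr : irreflexive dunion_adj.
Proof. by move=> [u|u] /=; rewrite adj_irr. Qed.
Definition dunion := SGraph dunion_sym dunion_irr.

Definition join_adj : rel (G + H)%type := fun x y =>
  match x, y with
  | inl u, inl v => adj u v
  | inr u, inr v => adj u v
  | _, _ => true
  end.
Lemma join_sym : symmetric join_adj.
Proof. by move=> [u|u] [v|v] //=; rewrite adj_sym. Qed.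
Lemma join_irr : irreflexive join_adj.
Proof. by move=> [u|u] /=; rewrite adj_irr. Qed.
Definition join := SGraph join_sym join_irr.
End Sums.

Definition complete_bipartite (p q : nat) : sgraph :=
  join (edgeless p) (edgeless q).

Definition ke (e : nat) : nat := \max_(k < e.+2 | 'C(k, 2) <= e) k.
Definition te (e : nat) : nat := e - 'C(ke e, 2).

(* The range of the maximum in [ke] is large enough. *)
Lemma keP (e : nat) : 'C(ke e, 2) <= e /\ (forall k, 'C(k, 2) <= e -> k <= ke e).
Proof.
split.
  rewrite /ke; elim/big_ind: _ => [//|x y Hx Hy|//].
  by case: (leqP x y).
move=> k hk.
have lt_k : k < e.+2.
  rewrite ltnNge; apply/negP => hek.
  have : 'C(e.+2, 2) <= 'C(k, 2) by rewrite leq_bin2l.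
  by rewrite binS bin1; lia.
exact: (@leq_bigmax_cond _ (fun k : 'I_e.+2 => 'C(k, 2) <= e)
          (fun k => k : nat) (Ordinal lt_k) hk).
Qed.

Definition Dgraph (n e : nat) : sgraph :=
  let k := ke e in let t := te e in
  if k + 2 <= n then
    join (dunion (join (dunion (complete (k - t)) (complete 1)) (complete t))
                 (edgeless (n - k - 2)))
         (complete 1)
  else complete n.

Definition Vgraph (n e : nat) : sgraph :=
  join (dunion (complete_bipartite 1 e) (edgeless (n - e - 2))) (complete 1).

Local Open Scope ring_scope.

Definition adjmx (F : pzSemiRingType) (G : sgraph) : 'M[F]_#|G| :=
  \matrix_(i, j) (adj (enum_val i) (enum_val j))%:R.

Definition is_spectral_radius (R : realType) (G : sgraph) (r : R) : Prop :=
  (exists2 z : R[i], eigenvalue (adjmx _ G) z & r = Normc.normc z) /\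
  (forall z : R[i], eigenvalue (adjmx _ G) z -> Normc.normc z <= r).

(* The default value 0 only matters for the graph on no vertices. *)
Definition spectral_radius (R : realType) (G : sgraph) : R :=
  xget 0 [set r : R | is_spectral_radius G r]%classic.

Lemma seq_argmax (R : realDomainType) (T : eqType) (f : T -> R) (s : seq T) :
  (0 < size s)%N -> exists2 z, z \in s & forall y, y \in s -> f y <= f z.
Proof.
elim: s => // a [|b s] IH _.
  by exists a => [|y]; rewrite inE // => /eqP ->.
have [//|z zs zmax] := IH.
have [le_az|lt_za] := leP (f a) (f z).
  exists z => [|y]; first by rewrite inE zs orbT.
  by rewrite inE => /predU1P[-> //|]; apply: zmax.
exists a => [|y]; first by rewrite inE eqxx.
by rewrite inE => /predU1P[-> //|/zmax h]; apply: le_trans h (ltW lt_za).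
Qed.

Lemma spectral_radiusP (R : realType) (G : sgraph) :
  (0 < #|G|)%N -> is_spectral_radius G (spectral_radius R G).
Proof.
move=> G0; apply: (@xgetPex _ 0 [set r : R | is_spectral_radius G r]%classic).
have [s Ds] := closed_field_poly_normal (char_poly (adjmx R[i] G)).
have /monicP mon := char_poly_monic (adjmx R[i] G).
rewrite mon scale1r in Ds.
have eigE z : eigenvalue (adjmx _ G) z = (z \in s).
  by rewrite eigenvalue_root_char Ds root_prod_XsubC.
have s0 : (0 < size s)%N.
  have := size_char_poly (adjmx R[i] G).
  by rewrite Ds size_prod_XsubC => -[->].
have [z zs zmax] := seq_argmax (@Normc.normc R) s0.
exists (Normc.normc z); split.
  by exists z; rewrite ?eigE.
by move=> y; rewrite eigE; apply: zmax.
Qed.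

Definition Psi (R : realType) (e : nat) : {poly R} :=
  let k : R := (ke e)%:R in let t : R := (te e)%:R in
    ((k - 1) * (k - 2) * (k ^+ 2 - 3 * k + 4 * t)) *: 'X^3
  - (k ^+ 5 - 6 * k ^+ 4 + k ^+ 3 * (4 * t + 15) - k ^+ 2 * (20 * t + 18)
     + k * (8 * t ^+ 2 + 24 * t + 8) - (4 * t ^+ 2 + 12 * t)) *: 'X^2
  - ((k ^+ 2 - k + 2 * t)
     * (k ^+ 3 + k ^+ 2 * (t - 4) - k * (3 * t - 5)
        + (4 * t ^+ 2 - 2 * t - 2))) *: 'X
  + (t * (k - t - 1) * (k ^+ 2 - 3 * k + 2 * t) * (k ^+ 2 - k + 2 * t))%:P.

Definition is_largest_root (R : realType) (p : {poly R}) (x : R) : Prop :=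
  root p x /\ (forall y, root p y -> y <= x).

(* The default value 0 is not used when 4 <= e; see psiP. *)
Definition psi (R : realType) (e : nat) : R :=
  xget 0 [set x : R | is_largest_root (Psi R e) x]%classic.

Lemma psiP (R : realType) (e : nat) :
  (4 <= e)%N -> is_largest_root (Psi R e) (psi R e).
Proof.
move=> e4.
apply: (@xgetPex _ 0 [set x : R | is_largest_root (Psi R e) x]%classic).
have szP : size (Psi R e) = 4%N.
  rewrite /Psi; set k : R := (ke e)%:R; set t : R := (te e)%:R.
  set c3 := (X in X *: 'X^3); set c2 := (X in X *: 'X^2).
  set c1 := (X in X *: 'X); set c0 := (X in X%:P).
  have [Ck kmax] := keP e.
  have k3 : (3 <= ke e)%N by apply: kmax; apply: leq_trans e4.
  have kR : 3 <= k by rewrite /k (ler_nat _ 3).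
  have tR : 0 <= t by rewrite /t ler0n.
  have kt : 0 < k - 3 + t.
    have : (3 < ke e + te e)%N.
      move: Ck; rewrite /te; case: (ltnP 3 (ke e)) => [|k3' _]; first by lia.
      have -> : ke e = 3%N by lia.
      by rewrite (_ : 'C(3, 2) = 3)%N //; lia.
    by rewrite -(ltr_nat R) natrD -/k -/t; lra.
  have c3_gt0 : 0 < c3.
    rewrite /c3; apply: mulr_gt0; first by apply: mulr_gt0; lra.
    nra.
  apply/eqP; rewrite eqn_leq; apply/andP; split.
    apply/leq_sizeP => j hj.
    rewrite !(coefD, coefN, coefZ, coefXn, coefX, coefC).
    by case: j hj => [|[|[|[|j]]]] //= _; rewrite !mulr0 !subr0 addr0.
  rewrite ltnNge; apply/negP => /leq_sizeP /(_ 3%N (leqnn _)).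
  rewrite !(coefD, coefN, coefZ, coefXn, coefX, coefC) /=.
  by rewrite !mulr0 !subr0 addr0 mulr1 => h; rewrite h ltxx in c3_gt0.
have P0 : Psi R e != 0 by rewrite -size_poly_eq0 szP.
have [x rx] : {x | root (Psi R e) x} by apply: odd_poly_root; rewrite szP.
pose s := rootsR (Psi R e).
have inS y : root (Psi R e) y = (y \in s).
  by rewrite -(roots_on_rootsR P0) in_itv.
have s0 : (0 < size s)%N by move: rx; rewrite inS; case: (s).
have [y ys ymax] := seq_argmax idfun s0.
by exists y; split=> [|z]; rewrite inS //; apply: ymax.
Qed.

Definition exactly_one (P Q S : Prop) : Prop :=
  [\/ [/\ P, ~ Q & ~ S], [/\ ~ P, Q & ~ S] | [/\ ~ P, ~ Q & S]].

(* Main.v *)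
Require Import Defs.
From mathcomp Require Import all_boot all_order all_algebra.
From mathcomp Require Import zify ring lra.
From mathcomp Require Import all_classical all_reals.
From mathcomp.real_closed Require Import complex.

(** Write [k], [t] for [ke e], [te e]. Deleting the dominating vertex (the
    apex) from either graph leaves isolated vertices and a core with exactly
    [e] edges: the star K_{1,e} for [Vgraph], the graph H = (K_{k-t} + K_1) v K_t
    for [Dgraph]. The order [n] enters only through the number of isolated
    vertices. A positive number is the spectral radius as soon as it has an
    entrywise positive eigenvector ([spectral_radius_pos_eigenvector]), so for
    each graph one solves the eigenvector equations, which are constant on the
    classes of twin vertices, and keeps the last one, that of the apex:
    - rho(V) is the root with x^2 > e of
        Vchar x = (x^2 - e) (x^2 - (n - 2)) - (x + e)^2;
    - rho(D) is a root of
        Dchar x = (x^2 - (n - k - 2)) Q x - x S x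
      at a point where Q > 0. Here Q = [core_char] is the essential factor of
      the characteristic polynomial of H, and S / Q = 1^T (x - A(H))^{-1} 1.

    On x^2 > e the function Vchar changes sign only once, upwards, so the sign
    of Vchar at d = rho(D) is that of rho(D) - rho(V). Now Dchar d = 0 allows
    [n] to be eliminated from Vchar d. The terms of degree 5 and 4 cancel, the
    latter because the cores have the same number of edges, and a cubic remains:
        Psi d = - 4 Q(d) Vchar d          ([Psi_core] and the theorem below).
    Hence Psi d has the sign of rho(V) - rho(D), with Q(d) > 0.

    It remains to see that Psi d also has the sign of d - psi. Let mu < d be a
    root of Q with mu >= k - 1. There the identity reads
    Psi mu = - 4 (mu^2 - e) mu S(mu) < 0, because mu^2 > e
    ([core_char_sqr_gt]). The leading coefficient of Psi is positive and its
    constant term is nonnegative, so that Psi x / x is convex for x > 0; a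
    convex function negative at mu vanishes at most once beyond mu, and there
    it turns positive. So psi > mu, and Psi has the sign of x - psi beyond mu
    ([Psi_sign]). The three cases are the three possible signs. *)

Set Implicit Arguments.
Unset Strict Implicit.
Unset Printing Implicit Defensive.

Import Order.TTheory GRing.Theory Num.Theory.

Local Open Scope ring_scope.

(** * Spectral radius from a positive eigenvector *)

Definition nbr_sum (R : pzRingType) (G : sgraph) (f : G -> R) (u : G) : R :=
  \sum_v (adj u v)%:R * f v.

Section PositiveEigenvector.
Variables (R : realType) (G : sgraph).

Lemma normc_sum (I : finType) (F : I -> R[i]) :
  Normc.normc (\sum_i F i) <= \sum_i Normc.normc (F i).
Proof.
elim/big_ind2: _ => [|x1 x2 y1 y2 h1 h2|//]; first by rewrite Normc.normc0.
by apply: le_trans (le_normcD _ _) _; apply: lerD.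
Qed.

Lemma normc_real (x : R) : 0 <= x -> Normc.normc (x%:C)%C = x.
Proof. by move=> x0; rewrite /Normc.normc /= expr0n /= addr0 sqrtr_sqr ger0_norm. Qed.

Lemma normc_ge0 (z : R[i]) : 0 <= Normc.normc z.
Proof. by case: z => a b; rewrite sqrtr_ge0. Qed.

(** Turns eigenvectors of the adjacency matrix, indexed by ordinals, into
    functions on the vertices; symmetry of [adj] absorbs the transposition, as
    [eigenvalue] is about row vectors. *)
Lemma eigenvalue_nbr_sum (F : fieldType) (z : F) :
  eigenvalue (adjmx F G) z <->
  exists2 g : G -> F, (exists u, g u != 0) & forall u, nbr_sum g u = z * g u.
Proof.
split.
  case/eigenvalueP=> v vz /rV0Pn [i vi]; exists (fun u => v 0 (enum_rank u)).
    by exists (enum_val i); rewrite enum_valK.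
  move=> u; have /rowP/(_ (enum_rank u)) := vz; rewrite !mxE => <-.
  rewrite /nbr_sum (reindex (@enum_val _ G)) /=; last first.
    by apply: onW_bij; exact: enum_val_bij.
  apply: eq_bigr => j _.
  by rewrite mxE enum_rankK enum_valK mulrC adj_sym.
case=> g [u gu] gz; apply/eigenvalueP; exists (\row_i g (enum_val i)).
  apply/rowP=> i; rewrite !mxE -gz /nbr_sum.
  rewrite (reindex (@enum_val _ G)) /=; last first.
    by apply: onW_bij; exact: enum_val_bij.
  by apply: eq_bigr => j _; rewrite !mxE mulrC adj_sym.
by apply/rV0Pn; exists (enum_rank u); rewrite mxE enum_rankK.
Qed.

(** If [g] is an eigenvector for [z], compare it with [f] at a vertex [w] where
    |g| / f is maximal, with value [h w]: then
    |z| |g w| <= sum of |g| over the neighbours of w <= h w * (x * f w) = x |g w|.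
    So [x] bounds the modulus of every eigenvalue. *)
Lemma spectral_radius_pos_eigenvector (f : G -> R) (x : R) (u0 : G) :
  0 <= x -> (forall u, 0 < f u) -> (forall u, nbr_sum f u = x * f u) ->
  spectral_radius R G = x.
Proof.
move=> x0 f0 fx.
have G0 : (0 < #|G|)%N by apply/card_gt0P; exists u0.
have xeig : eigenvalue (adjmx _ G) (x%:C)%C.
  apply/eigenvalue_nbr_sum; exists (fun u => ((f u)%:C)%C).
    by exists u0; rewrite fmorph_eq0 gt_eqF.
  move=> u; rewrite -rmorphM -fx /nbr_sum rmorph_sum.
  by apply: eq_bigr => v _; rewrite rmorphM rmorph_nat.
have xmax z : eigenvalue (adjmx R[i] G) z -> Normc.normc z <= x.
  case/eigenvalue_nbr_sum=> g [u1 gu1] gz.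
  pose h u := Normc.normc (g u) / f u.
  have [|w _ wmax] := @seq_argmax R _ h (enum G).
    by rewrite -cardE.
  have hmax v : Normc.normc (g v) <= h w * f v.
    by rewrite -ler_pdivrMr //; apply: wmax; rewrite mem_enum.
  have hw : 0 < h w.
    rewrite -(pmulr_lgt0 _ (f0 u1)); apply: lt_le_trans (hmax u1).
    rewrite lt_neqAle normc_ge0 andbT eq_sym.
    by apply: contra gu1 => /eqP/Normc.eq0_normc ->.
  have gw : Normc.normc (g w) = h w * f w by rewrite /h divfK // gt_eqF.
  rewrite -(ler_pM2r (mulr_gt0 hw (f0 w))) -{1}gw -Normc.normcM -gz.
  rewrite mulrCA -fx /nbr_sum mulr_sumr.
  apply: le_trans (normc_sum _) _; apply: ler_sum => v _.
  rewrite Normc.normcM mulrCA; case: (adj w v); last first.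
    by rewrite Normc.normc0 !mul0r.
  by rewrite Normc.normc1 !mul1r.
have [[z zeig ->] zmax] := spectral_radiusP R G0.
apply/le_anti; rewrite xmax //=.
by have := zmax _ xeig; rewrite normc_real // => /le_trans; apply.
Qed.

End PositiveEigenvector.

(** * Eigenvectors of the two graphs *)

Definition glue (R A B : Type) (f : A -> R) (g : B -> R) (v : A + B) : R :=
  match v with inl u => f u | inr w => g w end.

Section NbrSums.
Variable R : pzRingType.

Lemma nbr_sum_dunionl (G H : sgraph) (f : G -> R) (g : H -> R) u :
  @nbr_sum R (dunion G H) (glue f g) (inl u) = nbr_sum f u.
Proof.
rewrite /nbr_sum big_sumType /= [X in _ + X]big1 ?addr0 // => v _.
by rewrite mul0r.
Qed.

Lemma nbr_sum_dunionr (G H : sgraph) (f : G -> R) (g : H -> R) w :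
  @nbr_sum R (dunion G H) (glue f g) (inr w) = nbr_sum g w.
Proof.
rewrite /nbr_sum big_sumType /= [X in X + _]big1 ?add0r // => v _.
by rewrite mul0r.
Qed.

Lemma nbr_sum_joinl (G H : sgraph) (f : G -> R) (g : H -> R) u :
  @nbr_sum R (join G H) (glue f g) (inl u) = nbr_sum f u + \sum_w g w.
Proof.
rewrite /nbr_sum big_sumType /=; congr (_ + _).
by apply: eq_bigr => w _; rewrite mul1r.
Qed.

Lemma nbr_sum_joinr (G H : sgraph) (f : G -> R) (g : H -> R) w :
  @nbr_sum R (join G H) (glue f g) (inr w) = \sum_u f u + nbr_sum g w.
Proof.
rewrite /nbr_sum big_sumType /=; congr (_ + _).
by apply: eq_bigr => u _; rewrite mul1r.
Qed.

Lemma nbr_sum_complete n (c : R) (u : complete n) :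
  nbr_sum (fun=> c) u = n%:R * c - c.
Proof.
rewrite /nbr_sum (eq_bigr (fun v : 'I_n => c - (if v == u then c else 0))).
  by rewrite sumrB sumr_const card_ord -big_mkcond big_pred1_eq mulr_natl.
move=> v _ /=; rewrite /complete_adj eq_sym.
by case: eqP => _; rewrite ?mul0r ?mul1r ?subrr ?subr0.
Qed.

Lemma nbr_sum_edgeless n (f : edgeless n -> R) (u : edgeless n) :
  nbr_sum f u = 0.
Proof. by rewrite /nbr_sum big1 // => v _; rewrite mul0r. Qed.

Lemma sum_glue (A B : finType) (f : A -> R) (g : B -> R) :
  \sum_v glue f g v = \sum_u f u + \sum_w g w.
Proof. by rewrite big_sumType. Qed.

Lemma sum_ord_const n (c : R) : \sum_(i < n) c = n%:R * c.
Proof. by rewrite sumr_const card_ord mulr_natl. Qed.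

Definition nbr_sumE := (nbr_sum_dunionl, nbr_sum_dunionr, nbr_sum_joinl,
  nbr_sum_joinr, nbr_sum_complete, nbr_sum_edgeless, sum_glue, sum_ord_const).

End NbrSums.

Section CharacteristicFunctions.
Variable R : pzRingType.
Implicit Types k t m e N x : R.

(** The parameter [N] stands for n - 2. *)
Definition Vchar e N x := (x ^+ 2 - e) * (x ^+ 2 - N) - (x + e) ^+ 2.

(** The core H = (K_{k-t} + K_1) v K_t has characteristic polynomial
    [core_char] times a power of [x + 1]. *)
Definition core_char k t x :=
  (x - k + t + 1) * (x + 1) * (x - t) - t * (k - t) * x.

(** Sum over the vertices of H of the vector that the resolvent of H assigns to
    the constant vector [core_char k t x]; the three terms come from K_{k-t},
    K_1 and K_t. *)
Definition core_total k t x :=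
  (k - t) * (x * (x + 1)) + (x - k + t + 1) * (x + 1)
  + t * ((k - t) * x + (x - k + t + 1) * (x + 1)).

(** The parameter [m] is the number of pendant vertices. *)
Definition Dchar k t m x :=
  (x ^+ 2 - m) * core_char k t x - x * core_total k t x.

End CharacteristicFunctions.

(** The entries of the eigenvector are, in this order, those of the centre of
    the star, its leaves, the pendant vertices and the apex. They come from
    solving all equations but the one of the apex, which is [Vchar x = 0];
    x^2 > e makes them positive. *)
Lemma spectral_radius_V (R : realType) (n e : nat) (x : R) : (e + 2 <= n)%N ->
  0 < x -> e%:R < x ^+ 2 -> Vchar e%:R (n - 2)%:R x = 0 ->
  spectral_radius R (Vgraph n e) = x.
Proof.
move=> hn x0 ex; rewrite (_ : n - 2 = n - e - 2 + e)%N; last by lia.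
rewrite natrD /Vchar => eq0.
have e0 : 0 <= e%:R :> R by rewrite ler0n.
pose p := x ^+ 2 - e%:R.
pose f : Vgraph n e -> R :=
  glue (glue (glue (fun=> x * (x + e%:R)) (fun=> x * (x + 1))) (fun=> p))
    (fun=> x * p).
have p0 : 0 < p by rewrite subr_gt0.
apply: (@spectral_radius_pos_eigenvector R _ f x (inr ord0)); first exact: ltW.
  by move=> [[[u|u]|u]|u] /=; rewrite ?mulr_gt0 //; lra.
rewrite /f => -[[[u|u]|u]|u]; rewrite !nbr_sumE /p /=; try ring.
lra.
Qed.

(** The classes of twins are K_{k-t}, K_1 and K_t in the core, the pendant
    vertices and the apex. Solving the equations of the core makes the apex
    entry equal to [x * core_char k t x], and the equation of the apex is then
    [Dchar = 0]. The case [t = 0] is included: the class K_t is empty. *)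
Lemma spectral_radius_D (R : realType) (n e : nat) (x : R) : (ke e + 2 <= n)%N ->
  let k : R := (ke e)%:R in let t : R := (te e)%:R in
  (te e < ke e)%N -> 1 < k -> k - 1 < x ->
  0 < core_char k t x -> Dchar k t (n - ke e - 2)%:R x = 0 ->
  spectral_radius R (Dgraph n e) = x.
Proof.
move=> hn k t tk k1 kx Q0; rewrite /Dchar /core_total => eq0.
rewrite /Dgraph hn; set G := join _ _.
have t0 : 0 <= t by rewrite ler0n.
have t1 : t + 1 <= k by rewrite natr1 ler_nat.
have kt : (ke e - te e)%:R = k - t by rewrite natrB // ltnW.
pose u := x - k + t + 1.
pose a := core_char k t x.
pose y := u * (x + 1).
pose z := (k - t) * x + y.
pose f : G -> R :=
  glue (glue (glue (glue (fun=> x * (x * (x + 1))) (fun=> x * y)) (fun=> x * z))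
    (fun=> a)) (fun=> x * a).
have x0 : 0 < x by lra.
have x1 : 0 < x + 1 by lra.
have u0 : 0 < u by rewrite /u; lra.
have y0 : 0 < y by rewrite mulr_gt0.
have z0 : 0 < z by rewrite ltr_wpDl // mulr_ge0; lra.
apply: (@spectral_radius_pos_eigenvector R _ f x (inr ord0)); first exact: ltW.
  by rewrite /f => -[[[[v|v]|v]|v]|v] /=; rewrite ?mulr_gt0 //.
rewrite /f /G => -[[[[v|v]|v]|v]|v]; rewrite !nbr_sumE ?kt -?/k -?/t /=.
- rewrite /z /a /y /u /core_char; ring.
- rewrite /z /a /y /u /core_char; ring.
- rewrite /z /a /y /u /core_char; ring.
- ring.
rewrite /z /y /u /a; lra.
Qed.

(** * Roots and signs of the characteristic functions *)

Section Roots.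
Variable R : realType.
Implicit Types k t m e N x y mu : R.

Lemma single_crossing (f : R -> R) (P : R -> Prop) (r x : R) :
  (forall y z, P y -> y < z -> 0 <= f y -> 0 < f z) ->
  f r = 0 -> P r -> P x -> Num.sg (f x) = Num.sg (x - r).
Proof.
move=> incr fr Pr Px; have [xr|rx|->] := ltgtP x r.
- rewrite !ltr0_sg ?subr_lt0 // ltNge; apply/negP => fx.
  by have := incr _ _ Px xr fx; rewrite fr ltxx.
- by rewrite !gtr0_sg ?subr_gt0 // (incr _ _ Pr rx) // fr.
- by rewrite fr subrr.
Qed.

(** Dividing by x^2 - e > 0: the function x^2 - N - (x + e)^2 / (x^2 - e) is
    increasing. *)
Lemma Vchar_incr e N x y : 0 <= e -> 0 < x -> x < y -> e < x ^+ 2 ->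
  0 <= Vchar e N x -> 0 < Vchar e N y.
Proof.
move=> e0 x0 xy ex; rewrite /Vchar => h.
have y0 : 0 < y by lra.
have x2y2 : x ^+ 2 < y ^+ 2 by rewrite ltr_pXn2r // nnegrE ltW.
(* (z + e)^2 / (z^2 - e) decreases from x to y *)
have cross : (y + e) ^+ 2 * (x ^+ 2 - e) <= (x + e) ^+ 2 * (y ^+ 2 - e).
  rewrite -subr_ge0.
  have -> : (x + e) ^+ 2 * (y ^+ 2 - e) - (y + e) ^+ 2 * (x ^+ 2 - e) =
    (e + e ^+ 2) * (y ^+ 2 - x ^+ 2) + 2 * e * (y - x) * (x * y + e) by ring.
  by rewrite addr_ge0 // !mulr_ge0 ?subr_ge0 ?addr_ge0 ?sqr_ge0 ?mulr_ge0 // ltW.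
rewrite -(pmulr_rgt0 _ (_ : 0 < x ^+ 2 - e)) ?subr_gt0 //.
have h1 : 0 <= (y ^+ 2 - e) * ((x ^+ 2 - e) * (x ^+ 2 - N) - (x + e) ^+ 2).
  by rewrite mulr_ge0 //; lra.
have h2 : 0 < (y ^+ 2 - e) * (x ^+ 2 - e) * (y ^+ 2 - x ^+ 2).
  by rewrite !mulr_gt0 //; lra.
lra.
Qed.

Lemma Vchar_root e N : 4 <= e -> e <= N ->
  exists2 x, 0 < x /\ e < x ^+ 2 & Vchar e N x = 0.
Proof.
move=> e4 eN.
pose p : {poly R} := ('X^2 - e%:P) * ('X^2 - N%:P) - ('X + e%:P) ^+ 2.
have pE x : p.[x] = Vchar e N x by rewrite /p /Vchar !hornerE.
have se : Num.sqrt e ^+ 2 = e by rewrite sqr_sqrtr //; lra.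
have s0 := sqrtr_ge0 e.
have seN : Num.sqrt e <= 2 * N.
  by rewrite -(ler_pXn2r (_ : 0 < 2)%N) ?nnegrE ?se //; nra.
have fs : Vchar e N (Num.sqrt e) < 0.
  by rewrite /Vchar se subrr mul0r sub0r oppr_lt0 exprn_gt0 //; lra.
have fN : 0 <= Vchar e N (2 * N).
  have : (4 * N ^+ 2 - N) ^+ 2 <= ((2 * N) ^+ 2 - e) * ((2 * N) ^+ 2 - N).
    have : 0 <= (4 * N ^+ 2 - N) * (N - e) by rewrite mulr_ge0 //; nra.
    lra.
  have : (2 * N + e) ^+ 2 <= (4 * N ^+ 2 - N) ^+ 2.
    by rewrite ler_pXn2r // ?nnegrE; nra.
  by rewrite /Vchar; lra.
have [|x /andP[sx xN]] := @poly_ivt _ p _ _ seN; first by rewrite !pE ltW.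
rewrite /root pE => /eqP x0; exists x => //.
have {}sx : Num.sqrt e < x.
  by rewrite lt_neqAle sx andbT; apply: contra_eq_neq x0 => <-; lra.
by split; [lra|rewrite -se; nra].
Qed.

Lemma core_char_diag k t : core_char k t k = (k - t) * (k + t + 1).
Proof. by rewrite /core_char; ring. Qed.

Lemma core_char_pred k t : core_char k t (k - 1) = - t ^+ 2.
Proof. by rewrite /core_char; ring. Qed.

(** The core contains K_k and has maximum degree at most k, so its spectral
    radius lies between k - 1 and k. *)
Lemma core_char_root k t : 0 <= t -> t <= k - 1 ->
  exists2 x, k - 1 <= x <= k & core_char k t x = 0.
Proof.
move=> t0 tk.
pose p : {poly R} :=
  ('X - k%:P + t%:P + 1) * ('X + 1) * ('X - t%:P) - (t * (k - t)) *: 'X.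
have pE x : p.[x] = core_char k t x by rewrite /p /core_char !hornerE.
have [||x kx] := @poly_ivt _ p (k - 1) k; first by lra.
  rewrite !pE core_char_diag core_char_pred oppr_le0 sqr_ge0 /=.
  by rewrite mulr_ge0 //; lra.
by rewrite /root pE => /eqP; exists x.
Qed.

(** [core_char k t x / x] is, up to the constant t (k - t), a product of the
    increasing functions x - k + t + 1 and (x + 1) (x - t) / x. *)
Lemma core_char_incr k t x y : 0 <= t -> t <= k - 1 -> 1 < k ->
  k - 1 <= x -> x < y -> 0 <= core_char k t x -> 0 < core_char k t y.
Proof.
move=> t0 tk k1 kx xy; rewrite /core_char => h.
have x0 : 0 < x by lra.
pose d z := (z - k + t + 1) * ((z + 1) * (z - t)).
have dx : 0 <= d x - t * (k - t) * x by rewrite /d mulrA.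
suff : x * d y > y * d x by rewrite /d; nra.
have c1 : x - k + t + 1 < y - k + t + 1 by lra.
have c2 : y * ((x + 1) * (x - t)) < x * ((y + 1) * (y - t)).
  rewrite -subr_gt0 (_ : _ - _ = (y - x) * (x * y + t)); last by ring.
  by rewrite mulr_gt0 //; nra.
rewrite /d mulrCA [ltRHS]mulrCA.
have : 0 <= (x - k + t + 1) by lra.
have : 0 <= y * ((x + 1) * (x - t)) by rewrite !mulr_ge0 //; lra.
nra.
Qed.

Lemma core_total_gt0 k t x : 0 <= t -> t <= k - 1 -> 1 < k ->
  k - 1 <= x -> 0 < core_total k t x.
Proof.
move=> t0 tk k1 kx; rewrite /core_total.
have h1 : 0 < (k - t) * (x * (x + 1)) by rewrite !mulr_gt0 //; lra.
have h2 : 0 <= (x - k + t + 1) * (x + 1) by rewrite mulr_ge0 //; lra.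
have h3 : 0 <= (k - t) * x by rewrite mulr_ge0 //; lra.
nra.
Qed.

Lemma Dchar_root k t m mu : 0 <= t -> t <= k - 1 -> 1 < k -> 0 <= m ->
  k - 1 <= mu <= k -> core_char k t mu = 0 ->
  exists2 x, mu < x & Dchar k t m x = 0.
Proof.
move=> t0 tk k1 m0 /andP[kmu muk] Qmu.
pose q : {poly R} :=
  ('X - k%:P + t%:P + 1) * ('X + 1) * ('X - t%:P) - (t * (k - t)) *: 'X.
pose s : {poly R} := (k - t) *: ('X * ('X + 1))
  + ('X - k%:P + t%:P + 1) * ('X + 1)
  + t *: ((k - t) *: 'X + ('X - k%:P + t%:P + 1) * ('X + 1)).
pose p : {poly R} := ('X^2 - m%:P) * q - 'X * s.
have pE x : p.[x] = Dchar k t m x.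
  by rewrite /p /s /q /Dchar /core_char /core_total !hornerE.
have pmu : Dchar k t m mu < 0.
  rewrite /Dchar Qmu mulr0 sub0r oppr_lt0 mulr_gt0 //; first by lra.
  exact: core_total_gt0.
(* the degree n - 1 of the apex, which bounds the spectral radius *)
pose B := k + 1 + m.
have muB : mu <= B by rewrite /B; lra.
have pB : 0 <= Dchar k t m B.
  pose a := core_char k t B.
  pose z := (k - t) * B + (B - k + t + 1) * (B + 1).
  (* at x = B the entries of the core, ordered y <= B (B + 1) <= z, do not exceed
     that of the apex *)
  have yx : (B - k + t + 1) * (B + 1) <= B * (B + 1).
    by rewrite ler_wpM2r // /B; lra.
  have xz : B * (B + 1) <= z by rewrite /z /B; lra.
  have za : z <= a.
    rewrite /z /a /core_char -subr_ge0.
    have -> : (B - k + t + 1) * (B + 1) * (B - t) - t * (k - t) * B -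
      ((k - t) * B + (B - k + t + 1) * (B + 1)) =
      (B - k + t + 1) * ((B + 1) * (B - t - 1)) - (t + 1) * (B * (k - t)) by ring.
    have h1 : B * (k - t) <= (B + 1) * (B - t - 1) by rewrite /B; nra.
    have h2 : 0 <= B * (k - t) by rewrite mulr_ge0 // /B; lra.
    have h3 : t + 1 <= B - k + t + 1 by rewrite /B; lra.
    nra.
  have sa : core_total k t B <= (k + 1) * a by rewrite /core_total -/z; nra.
  have a0 : 0 <= a by apply: le_trans za; apply: le_trans xz; rewrite /B; nra.
  have : B * core_total k t B <= B * ((k + 1) * a).
    by rewrite ler_wpM2l // /B; lra.
  rewrite /Dchar -/a.
  suff : 0 <= (B ^+ 2 - m - B * (k + 1)) * a by lra.
  by rewrite mulr_ge0 // /B; nra.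
have [|x /andP[mux _]] := @poly_ivt _ p _ _ muB; first by rewrite !pE ltW.
rewrite /root pE => /eqP x0; exists x => //.
by rewrite lt_neqAle mux andbT; apply: contra_eq_neq x0 => <-; lra.
Qed.

(** Taken at x = rho(H), this says that rho(K_{1,e})^2 = e < rho(H)^2. As
    x >= k - 1 and 2 e <= (k - 1) (k + 2), the nonstrict inequality is immediate
    for k >= 4; strictness comes from 2 e = k (k - 1) if t = 0, and from
    [core_char_pred], which excludes x = k - 1, if not. For k = 3 only t = 1 and
    t = 2 are left. *)
Lemma core_char_sqr_gt (K T : nat) x : let k : R := K%:R in let t : R := T%:R in
  (3 <= K)%N -> (T < K)%N -> (3 < K + T)%N ->
  k - 1 <= x -> 0 <= core_char k t x -> (k * (k - 1) + 2 * t) / 2 < x ^+ 2.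
Proof.
move=> k t K3 TK KT kx Qx.
have t_le : t <= k - 1 by rewrite lerBrDr natr1 ler_nat.
have kx' : (0 < T)%N -> k - 1 < x.
  move=> T0; rewrite lt_neqAle kx andbT; apply/eqP => E.
  have t0 : 0 < t by rewrite ltr0n.
  move: Qx; rewrite -E core_char_pred.
  by rewrite oppr_ge0 leNgt exprn_gt0.
rewrite ltr_pdivrMr ?ltr0n //.
have [K4|K4] := leqP 4 K.
  have k4 : 4 <= k by rewrite (ler_nat _ 4).
  have [T0|T0] := posnP T.
    by rewrite /t T0; nra.
  by have := kx' T0; nra.
have EK : K = 3%N by lia.
have [ET|ET] : T = 1%N \/ T = 2%N by lia.
  by have := kx' ltac:(lia); rewrite /k /t EK ET; nra.
move: Qx kx; rewrite /core_char /k /t EK ET => Qx kx.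
have : 0 <= x * (x ^+ 2 - x - 4) by lra.
rewrite pmulr_rge0; last by lra.
nra.
Qed.

(** * The sign of the cubic [Psi] *)

(** With [a, d >= 0] the function p z / z = a z^2 - b z - c + d / z is convex
    on z > 0. *)
Lemma cubic_single_crossing (a b c d mu y x : R) :
  let p z := a * z ^+ 3 - b * z ^+ 2 - c * z + d in
  0 <= a -> 0 <= d -> 0 < mu -> mu < y -> y < x ->
  p mu < 0 -> 0 <= p y -> 0 < p x.
Proof.
move=> p a0 d0 mu0 muy yx pmu py.
have y0 : 0 < y by lra. have x0 : 0 < x by lra.
have conv : (x - mu) * (x * mu) * p y <=
    (x - y) * (x * y) * p mu + (y - mu) * (y * mu) * p x.
  rewrite -subr_ge0 (_ : _ - _ =
    (x - y) * (y - mu) * (x - mu) * (a * (x * y * mu) + d)); last by rewrite /p; ring.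
  by rewrite mulr_ge0 ?addr_ge0 ?mulr_ge0 ?subr_ge0 // ltW //; lra.
have h1 : (x - y) * (x * y) * p mu < 0 by rewrite nmulr_llt0 ?mulr_gt0 ?subr_gt0.
have h2 : 0 <= (x - mu) * (x * mu) * p y by rewrite !mulr_ge0 ?subr_ge0 // ltW //; lra.
rewrite -(pmulr_rgt0 _ (_ : 0 < (y - mu) * (y * mu))); first by lra.
by rewrite !mulr_gt0 ?subr_gt0.
Qed.

Lemma cubic_eventually_ge0 (a b c d mu : R) : 0 < a -> 0 <= d -> 0 < mu ->
  exists2 x, mu <= x & 0 <= a * x ^+ 3 - b * x ^+ 2 - c * x + d.
Proof.
move=> a0 d0 mu0; pose q := (`|b| + `|c|) / a.
have q0 : 0 <= q by rewrite mulr_ge0 ?addr_ge0 ?invr_ge0 // ltW.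
have qE : a * q = `|b| + `|c| by rewrite mulrC divfK // gt_eqF.
(* beyond 1 and (|b| + |c|) / a the cubic term outweighs the next two *)
exists (1 + mu + q); first by lra.
set x := 1 + mu + q.
have x1 : 1 <= x by rewrite /x; lra.
have hb : b * x ^+ 2 <= `|b| * x ^+ 2.
  by rewrite ler_wpM2r ?sqr_ge0 // ler_norm.
have hc : c * x <= `|c| * x ^+ 2.
  apply: (@le_trans _ _ (`|c| * x)); first by rewrite ler_wpM2r ?ler_norm //; lra.
  by rewrite ler_wpM2l // expr2 ler_peMr //; lra.
have : 0 <= (a * x - `|b| - `|c|) * x ^+ 2.
  by rewrite mulr_ge0 ?sqr_ge0 // /x !mulrDr qE; nra.
lra.
Qed.

(** The form in which [Psi] compares the two cores: at a root of [Dchar] the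
    factor [x * core_total - k * core_char] is [core_char] times x^2 - (n - 2). *)
Lemma Psi_core E x : let k : R := (ke E)%:R in let t : R := (te E)%:R in
  let e := (k * (k - 1) + 2 * t) / 2 in
  (Psi R E).[x] = 4 * ((x + e) ^+ 2 * core_char k t x -
    (x ^+ 2 - e) * (x * core_total k t x - k * core_char k t x)).
Proof.
move=> k t e; rewrite /Psi -/k -/t.
rewrite !(hornerD, hornerN, hornerZ, hornerXn, hornerX, hornerC).
rewrite /core_char /core_total /e.
clearbody k t => {e}.
by field.
Qed.

(** The two coefficient signs that make [Psi x / x] convex. *)
Lemma Psi_cubic E : (3 <= ke E)%N -> (te E < ke E)%N -> (3 < ke E + te E)%N ->
  exists a b c d : R, [/\ 0 < a, 0 <= d &
    forall x, (Psi R E).[x] = a * x ^+ 3 - b * x ^+ 2 - c * x + d].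
Proof.
move=> K3 TK KT.
(* the coefficients are read off the expansion, hence the last component first *)
do 4!eexists; split; last first.
- move=> x; rewrite /Psi.
  rewrite !(hornerD, hornerN, hornerZ, hornerXn, hornerX, hornerC).
  reflexivity.
- have k3 : 3 <= (ke E)%:R :> R by rewrite (ler_nat _ 3).
  have tk : (te E)%:R + 1 <= (ke E)%:R :> R by rewrite natr1 ler_nat.
  have t0 : 0 <= (te E)%:R :> R by rewrite ler0n.
  by rewrite !mulr_ge0 //; [lra|nra|nra].
have k3 : 3 <= (ke E)%:R :> R by rewrite (ler_nat _ 3).
have kt : 4 <= (ke E)%:R + (te E)%:R :> R by rewrite -natrD (ler_nat _ 4).
by rewrite !mulr_gt0 //; [lra|lra|nra].
Qed.

(** A negative value at [mu] > 0 forces the largest root beyond [mu], where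
    convexity of [Psi x / x] leaves room for only one crossing. *)
Lemma Psi_sign E mu x : (4 <= E)%N ->
  (3 <= ke E)%N -> (te E < ke E)%N -> (3 < ke E + te E)%N ->
  0 < mu -> (Psi R E).[mu] < 0 -> mu < x ->
  Num.sg (Psi R E).[x] = Num.sg (x - psi R E).
Proof.
move=> E4 K3 TK KT mu0 Pmu mux; set p := Psi R E in Pmu *.
have [psi_root psi_max] := psiP R E4.
have [a [b [c [d [a0 d0 pE]]]]] := Psi_cubic K3 TK KT.
have mupsi : mu < psi R E.
  have [y muy py] : exists2 y, mu <= y & 0 <= p.[y].
    have [y muy py] := cubic_eventually_ge0 b c a0 d0 mu0.
    by exists y; rewrite // pE.
  have [|z /andP[muz _] pz] := @poly_ivt _ p _ _ muy; first by rewrite ltW.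
  apply: lt_le_trans (psi_max _ pz).
  rewrite lt_neqAle muz andbT; apply: contraTneq pz => <-.
  by rewrite /root lt_eqF.
apply: (@single_crossing (horner p) (fun y => mu < y)) => //; last exact/rootP.
move=> y z muy yz; move: Pmu; rewrite !pE => Pmu Py.
exact: (cubic_single_crossing (ltW a0) d0 mu0 muy yz Pmu Py).
Qed.

End Roots.

(** * The parameters [ke] and [te] *)

Lemma te_lt_ke e : (te e < ke e)%N.
Proof.
have [Ck kmax] := keP e; rewrite ltnNge; apply/negP => h.
suff : ((ke e).+1 <= ke e)%N by rewrite ltnn.
by apply: kmax; rewrite binS bin1; move: h; rewrite /te; lia.
Qed.

Lemma edges_ke_te e : (e * 2 = ke e * (ke e).-1 + te e * 2)%N.
Proof.
have [Ck _] := keP e.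
have := bin_ffact (ke e) 2; rewrite ffactnS ffactn1 /te => h.
have {}h : ('C(ke e, 2) * 2 = ke e * (ke e).-1)%N by [].
by rewrite -h -mulnDl subnKC.
Qed.

Lemma ke_ge3 e : (4 <= e)%N -> (3 <= ke e)%N.
Proof. by move=> e4; have [_ kmax] := keP e; apply: kmax; apply: leq_trans e4. Qed.

Lemma ke_te_gt3 e : (4 <= e)%N -> (3 < ke e + te e)%N.
Proof.
move=> e4; have k3 := ke_ge3 e4; have eE := edges_ke_te e.
case: (ltnP 3 (ke e)) => [|k3']; first by lia.
have ke3 : ke e = 3%N by lia.
by rewrite ke3 in eE *; lia.
Qed.

Lemma ke_le e : (4 <= e)%N -> (ke e <= e)%N.
Proof. by move=> e4; have k3 := ke_ge3 e4; have := edges_ke_te e; nia. Qed.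

Lemma edges_real (R : realType) e : let k : R := (ke e)%:R in
  let t : R := (te e)%:R in e%:R = (k * (k - 1) + 2 * t) / 2.
Proof.
move=> k t; apply: (canRL (mulfK _)); first by rewrite pnatr_eq0.
have k0 : (0 < ke e)%N by apply: leq_ltn_trans (te_lt_ke e).
have -> : k - 1 = (ke e).-1%:R by rewrite /k -{1}(prednK k0) -natr1 addrK.
by rewrite /k /t -!natrM -natrD edges_ke_te [(te e * 2)%N]mulnC.
Qed.

(** * Comparing the two spectral radii *)

Theorem proposition4p1 (R : realType) (e n : nat)
    (he : (4 <= e)%N) (hn : (e + 2 <= n)%N) :
  let rhoV : R := spectral_radius R (Vgraph n e) in
  let rhoD : R := spectral_radius R (Dgraph n e) in
  exactly_one
    (rhoV < rhoD /\ rhoD < psi R e)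
    (rhoV = rhoD /\ rhoD = psi R e)
    (rhoV > rhoD /\ rhoD > psi R e).
Proof.
move=> rhoV rhoD.
have K3 := ke_ge3 he; have TK := te_lt_ke e; have KT := ke_te_gt3 he.
have Ke := ke_le he.
pose k : R := (ke e)%:R; pose t : R := (te e)%:R; pose E : R := e%:R.
have EE : E = (k * (k - 1) + 2 * t) / 2 by exact: edges_real.
have E4 : 4 <= E by rewrite (ler_nat _ 4).
have k3 : 3 <= k by rewrite (ler_nat _ 3).
have k1 : 1 < k by lra.
have t0 : 0 <= t by rewrite ler0n.
have tk : t <= k - 1 by rewrite lerBrDr natr1 ler_nat.
have [mu kmuk Qmu] := core_char_root t0 tk.
have /andP[kmu _] := kmuk.
have mu0 : 0 < mu by lra.
have [d mud Dd] := Dchar_root t0 tk k1 (ler0n R (n - ke e - 2)) kmuk Qmu.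
have Qd : 0 < core_char k t d.
  by apply: core_char_incr mud _ => //; rewrite Qmu.
have rhoDE : rhoD = d.
  by apply: spectral_radius_D Dd => //; [lia|rewrite -/k; lra].
have [|v [v0 vE] Vv] := @Vchar_root R E (n - 2)%:R E4.
  by rewrite ler_nat; lia.
have rhoVE : rhoV = v by apply: spectral_radius_V Vv.
have sqr_gt x : k - 1 <= x -> 0 <= core_char k t x -> E < x ^+ 2.
  by rewrite EE; exact: core_char_sqr_gt.
have signV : Num.sg (Vchar E (n - 2)%:R d) = Num.sg (d - v).
  apply: (@single_crossing _ _ (fun x => 0 < x /\ E < x ^+ 2)) => //.
    by move=> y z [y0 yE] yz; apply: Vchar_incr => //; lra.
  by split; [lra|apply: sqr_gt; lra].
have signPsi : Num.sg (Psi R e).[d] = Num.sg (d - psi R e).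
  apply: (@Psi_sign _ _ mu) => //.
  rewrite Psi_core -/k -/t -EE Qmu !mulr0 subr0 sub0r mulrN oppr_lt0.
  rewrite !mulr_gt0 ?subr_gt0 //; first by apply: sqr_gt; rewrite ?Qmu.
  exact: core_total_gt0.
have Psid : (Psi R e).[d] = - (4 * core_char k t d * Vchar E (n - 2)%:R d).
  rewrite Psi_core -/k -/t -EE /Vchar.
  rewrite (_ : (n - 2)%:R = (n - ke e - 2)%:R + k); last first.
    by rewrite -natrD; congr _%:R; lia.
  by move: Dd; rewrite /Dchar => /subr0_eq <-; ring.
have : Num.sg (d - psi R e) = Num.sg (v - d).
  rewrite -signPsi Psid -mulrN sgrM gtr0_sg ?mulr_gt0 // mul1r sgrN signV.
  by rewrite -sgrN opprB.
rewrite rhoDE rhoVE; have [dpsi|psid|dpsi] := ltgtP d (psi R e).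
- rewrite ltr0_sg ?subr_lt0 // => /esym/eqP; rewrite sgr_cp0 subr_lt0 => vd.
  by constructor 1; split=> // -[]; lra.
- rewrite gtr0_sg ?subr_gt0 // => /esym/eqP; rewrite sgr_cp0 subr_gt0 => dv.
  by constructor 3; split=> // -[]; lra.
rewrite -dpsi subrr sgr0 => /esym/eqP; rewrite sgr_cp0 subr_eq0 => /eqP ->.
by constructor 2; split=> // -[]; lra.
Qed.
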